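(* If $G\in\mathbb{C}^{m\times m}$ is positive definite and $\alpha\in\mathbb{C}\setminus\mathbb{R}$, then the following statements are equivalent: (1) $G$ is a block Hankel matrix. (2) The isometry $\langle T_\alpha f,T_\alpha f\rangle_{\mathcal{H}_G}=\langle f,f\rangle_{\mathcal{H}_G}$ holds for every $f\in(\mathcal{H}_G)_\alpha$. (3) $(\lambda-\overline{\alpha})(\overline{\omega}-\alpha)F(\lambda)N_\alpha F(\omega)^*=(\lambda-\alpha)(\overline{\omega}-\overline{\alpha})F(\lambda)N_{\overline{\alpha}}F(\omega)^*$ for all $\lambda,\omega\in\mathbb{C}$. (4) $(\lambda-\overline{\alpha})F(\lambda)N_\alpha(I_m-\alpha A^* )=(\lambda-\alpha)F(\lambda)N_{\overline{\alpha}}(I_m-\overline{\alpha}A^* )$ for all $\lambda\in\mathbb{C}$. (5) $(I_m-\overline{\alpha}A)N_\alpha(I_m-\alpha A^* )=(I_m-\alpha A)N_{\overline{\alpha}}(I_m-\overline{\alpha}A^* )$. Moreover, the identities (3) (for all $\lambda,\omega\in\mathbb{C}$), (4) (for all $\lambda\in\mathbb{C}$) and (5) are equivalent for every choice of $\alpha\in\mathbb{C}$.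
   Context: $p,n\ge1$ are fixed integers, $m=(n+1)p$, $F(\lambda)=\begin{bmatrix}I_p&\lambda I_p&\cdots&\lambda^nI_p\end{bmatrix}$, $\Gamma=G^{-1}$. $G$ has $p\times p$ blocks $g_{ij}$, $i,j=0,\ldots,n$, and is block Hankel if $g_{ij}$ depends only on $i+j$. $A\in\mathbb{C}^{m\times m}$ is the block matrix with $I_p$ in the block positions $(j,j+1)$, $j=0,\ldots,n-1$, and zeros elsewhere. $\mathcal{H}_G=\{Fu:u\in\mathbb{C}^m\}$ with inner product $\langle Fu,Fv\rangle_{\mathcal{H}_G}=v^*Gu$, and $(\mathcal{H}_G)_\alpha=\{f\in\mathcal{H}_G:f(\alpha)=0\}$. $(R_\alpha f)(\lambda)=\frac{f(\lambda)-f(\alpha)}{\lambda-\alpha}$ for $\lambda\ne\alpha$, $(R_\alpha f)(\alpha)=f'(\alpha)$, and $T_\alpha=I+(\alpha-\overline{\alpha})R_\alpha$. For $\beta\in\mathbb{C}$, $\mathfrak{z}_\beta=\Gamma F(\beta)^*(F(\beta)\Gamma F(\beta)^* )^{-1/2}$ and $N_\beta=\Gamma-\mathfrak{z}_\beta\mathfrak{z}_\beta^*$. *)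

(* Defs.v *)
From mathcomp Require Import all_boot all_order all_algebra.
From mathcomp Require Import all_classical all_reals all_analysis.
From mathcomp Require Import complex ring.

Set Implicit Arguments.
Unset Strict Implicit.
Unset Printing Implicit Defensive.

Import Order.TTheory GRing.Theory Num.Theory.
Import numFieldNormedType.Exports.

Local Open Scope classical_set_scope.
Local Open Scope ring_scope.
Local Open Scope sesquilinear_scope.

(* The dimension m = (n + 1) p, in the form expected by \mxrow, \mxblock and
   submxblock for n + 1 blocks of size p. *)
Notation blockdim n p := (\sum_(i < n.+1) p)%N.

Lemma blockdimE n p : blockdim n p = (n.+1 * p)%N.
Proof. by rewrite sum_nat_const card_ord. Qed.

Section PositiveDefinite.
Variable R : realType.

(* In R[i], 0 < z says that z is real and positive; positive definite matrices
   are therefore Hermitian. *)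
Definition posdefmx d (G : 'M[R[i]]_d) : Prop :=
  forall u : 'cV[R[i]]_d, u != 0 -> 0 < (u^t* *m G *m u) 0 0.

(* The power -1/2 of a positive definite matrix, by functional calculus on its
   unitary diagonalization; see invsqrtmx_posdef and invsqrtmx_sqr. *)
Definition invsqrtmx d (M : 'M[R[i]]_d) : 'M[R[i]]_d :=
  invmx (spectralmx M)
    *m diag_mx (map_mx (fun x => (sqrtC x)^-1) (spectral_diag M))
    *m spectralmx M.

End PositiveDefinite.

Section BlockHankel.
Variables (R : realType) (n p : nat).
Local Notation C := R[i].
Local Notation m := (blockdim n p).

Definition block_hankel (G : 'M[C]_m) : Prop :=
  forall i j k l : 'I_n.+1, (i + j = k + l)%N ->
    submxblock G i j = submxblock G k l.

Definition Fmx (lambda : C) : 'M[C]_(p, m) :=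
  \mxrow_(i < n.+1) (lambda ^+ i)%:M.

Definition shiftmx : 'M[C]_m :=
  \mxblock_(i < n.+1, j < n.+1)
    (if j == i.+1 :> nat then 1%:M else 0 : 'M[C]_p).

Definition Fmap (u : 'cV[C]_m) : C -> 'cV[C]_p := fun lambda => Fmx lambda *m u.

Definition Hspace : set (C -> 'cV[C]_p) := range Fmap.

Definition Hspace_at (alpha : C) : set (C -> 'cV[C]_p) :=
  [set f | Hspace f /\ f alpha = 0].

(* The vector u with f = F u, which is unique (Fmap_inj); junk value 0 when f
   is not in Hspace. *)
Definition Hcoef (f : C -> 'cV[C]_p) : 'cV[C]_m := xget 0 [set u | f = Fmap u].

Definition Hdot (G : 'M[C]_m) (f g : C -> 'cV[C]_p) : C :=
  ((Hcoef g)^t* *m G *m Hcoef f) 0 0.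

Definition Rshift (alpha : C) (f : C -> 'cV[C]_p) : C -> 'cV[C]_p :=
  fun lambda => if lambda == alpha then derive1 f alpha
                else (lambda - alpha)^-1 *: (f lambda - f alpha).

Definition Tmap (alpha : C) (f : C -> 'cV[C]_p) : C -> 'cV[C]_p :=
  fun lambda => f lambda + (alpha - alpha^*) *: Rshift alpha f lambda.

Definition zmx (G : 'M[C]_m) (beta : C) : 'M[C]_(m, p) :=
  invmx G *m (Fmx beta)^t* *m
    invsqrtmx (Fmx beta *m invmx G *m (Fmx beta)^t*).

Definition Nmx (G : 'M[C]_m) (beta : C) : 'M[C]_m :=
  invmx G - zmx G beta *m (zmx G beta)^t*.

Definition Tmap_isometry (G : 'M[C]_m) (alpha : C) : Prop :=
  forall f, Hspace_at alpha f ->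
    Hdot G (Tmap alpha f) (Tmap alpha f) = Hdot G f f.

Definition N_kernel_identity (G : 'M[C]_m) (alpha : C) : Prop :=
  forall lambda omega : C,
    ((lambda - alpha^*) * (omega^* - alpha)) *:
      (Fmx lambda *m Nmx G alpha *m (Fmx omega)^t*) =
    ((lambda - alpha) * (omega^* - alpha^*)) *:
      (Fmx lambda *m Nmx G alpha^* *m (Fmx omega)^t*).

Definition N_row_identity (G : 'M[C]_m) (alpha : C) : Prop :=
  forall lambda : C,
    (lambda - alpha^*) *:
      (Fmx lambda *m Nmx G alpha *m (1%:M - alpha *: shiftmx^t*)) =
    (lambda - alpha) *:
      (Fmx lambda *m Nmx G alpha^* *m (1%:M - alpha^* *: shiftmx^t*)).

Definition N_matrix_identity (G : 'M[C]_m) (alpha : C) : Prop :=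
  (1%:M - alpha^* *: shiftmx) *m Nmx G alpha *m (1%:M - alpha *: shiftmx^t*) =
  (1%:M - alpha *: shiftmx) *m Nmx G alpha^* *m
    (1%:M - alpha^* *: shiftmx^t*).

End BlockHankel.

Lemma derive1_factor (K : numFieldType) (V : normedModType K) (f g : K -> V) a :
  (forall x, f x - f a = (x - a) *: g x) -> {for a, continuous g} ->
  derive1 f a = g a.
Proof.
move=> fg g_cont; apply: cvg_lim => //.
have E : {near 0^', (fun h => g (h + a)) =1
                    (fun h => h^-1 *: (f (h + a) - f a))}.
  by near=> h; rewrite fg addrK scalerK//; near: h; exact: nbhs_dnbhs_neq.
apply: cvg_trans; first exact: (near_eq_cvg E).
have ha : (h + a) @[h --> (0 : K)^'] --> (0 : K) + a.
  by apply: cvgD; [exact: nbhs_dnbhs|exact: cvg_cst].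
by rewrite add0r in ha; exact: (cvg_comp _ _ ha g_cont).
Unshelve. all: by end_near. Qed.

Lemma powers_continuous (K : numFieldType) (V : normedModType K) n
    (c : 'I_n -> V) (a : K) :
  {for a, continuous (fun x : K => \sum_(i < n) x ^+ i *: c i)}.
Proof.
have powC k : (x : K) ^+ k @[x --> a] --> a ^+ k.
  elim: k => [|k IH].
    rewrite expr0 (_ : (fun x : K => _) = cst 1); first by
      apply: cvg_cst; exact: nbhs_filter.
    by apply/funext => x; rewrite expr0.
  rewrite exprS (_ : (fun x : K => _) = id \* (fun x => x ^+ k)).
    by apply: cvgM IH; apply: cvg_id.
  by apply/funext => x; rewrite exprS.
apply: (@cvg_big _ _ +%R 0 xpredT _ K (nbhs a) (index_enum 'I_n)
  (fun i x => x ^+ i *: c i) (fun i => a ^+ i *: c i)) => [|i _].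
  exact: add_continuous.
by apply: cvgZr_tmp; exact: powC.
Qed.

Lemma derive1_powers (K : numFieldType) (V : normedModType K) n
    (f : K -> V) (c : 'I_n -> V) (a : K) :
  (forall x, f x - f a = (x - a) *: \sum_(i < n) x ^+ i *: c i) ->
  derive1 f a = \sum_(i < n) a ^+ i *: c i.
Proof.
move=> fE; apply: (derive1_factor (g := fun x => \sum_(i < n) x ^+ i *: c i)).
  exact: fE.
exact: powers_continuous.
Qed.

Section Adequacy.
Variable R : realType.
Local Notation C := R[i].

Lemma posdefmx_hermitian d (M : 'M[C]_d) : posdefmx M -> M^t* = M.
Proof.
move=> M_pos; pose D := M - M^t*.
have D0 (u : 'cV[C]_d) : (u^t* *m D *m u) 0 0 = 0.
  have [->|u0] := eqVneq u 0; first by rewrite mulmx0 mxE.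
  rewrite mulmxBr mulmxBl mxE [X in _ + X]mxE.
  have -> : (u^t* *m M^t* *m u) 0 0 = ((u^t* *m M *m u) 0 0)^*.
    transitivity ((u^t* *m M *m u)^t* 0 0); last by rewrite !mxE.
    by rewrite !trmx_mul !map_mxM trmxCK mulmxA.
  by rewrite (CrealP (gtr0_real (M_pos u u0))) subrr.
have Dij i j c : D i i + c * D i j + c^* * (D j i + c * D j j) = 0.
  have := D0 (delta_mx i 0 + c *: delta_mx j 0).
  have -> : (delta_mx i 0 + c *: delta_mx j 0 : 'cV[C]_d)^t*
      = delta_mx 0 i + c^* *: delta_mx 0 j.
    apply/matrixP => x y; rewrite !mxE rmorphD rmorphM !rmorph_nat.
    by rewrite ![_ && (x == 0)]andbC.
  rewrite mulmxDl mulmxDr mulmxDl -!scalemxAl -!rowE !mulmxDl -!scalemxAl.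
  rewrite -!scalemxAr -!colE !mxE => <-; ring.
have Dii i : D i i = 0 by have := Dij i i 0; rewrite conjC0 !mul0r !addr0.
have Dij0 i j : D i j = 0.
  have := Dij i j 1; have := Dij i j 'i; rewrite !Dii conjC1 conjCi !mulr0.
  rewrite !(add0r, addr0) !mul1r mulNr -mulrBr => /eqP.
  rewrite mulf_eq0 (negPf (neq0Ci _)) /= subr_eq0 => /eqP <- /eqP.
  by rewrite -mulr2n mulrn_eq0 => /eqP.
by apply/eqP; rewrite eq_sym -subr_eq0; apply/eqP/matrixP => i j; rewrite Dij0 mxE.
Qed.

Lemma posdefmx_spectral d (M : 'M[C]_d) : posdefmx M ->
  M = (spectralmx M)^t* *m diag_mx (spectral_diag M) *m spectralmx M
  /\ forall k, 0 < spectral_diag M 0 k.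
Proof.
move=> M_pos; set P := spectralmx M; set D := spectral_diag M.
have PU : P \is unitarymx by exact: spectral_unitarymx.
have ME : M = P^t* *m diag_mx D *m P.
  rewrite -(invmx_unitary PU); apply/orthomx_spectralP/normalmxP.
  by rewrite posdefmx_hermitian.
split=> // k; have [u Pu] : exists u : 'cV[C]_d, P *m u = delta_mx k 0.
  by exists (P^t* *m delta_mx k 0); rewrite mulmxA (unitarymxP PU) mul1mx.
have u0 : u != 0.
  apply/eqP => u0; have /matrixP/(_ k 0)/eqP := Pu.
  by rewrite u0 mulmx0 !mxE !eqxx eq_sym oner_eq0.
have := M_pos u u0; rewrite {1}ME !mulmxA -[_ *m P *m u]mulmxA Pu.
have -> : u^t* *m P^t* = delta_mx 0 k.
  by rewrite -map_mxM -trmx_mul Pu trmx_delta map_delta_mx.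
by rewrite -rowE -colE !mxE eqxx.
Qed.

Lemma invsqrtmx_posdef d (M : 'M[C]_d) :
  posdefmx M -> posdefmx (invsqrtmx M).
Proof.
move=> /posdefmx_spectral[_ D0] u u0; rewrite /invsqrtmx.
set P := spectralmx M; set S := map_mx (fun x => (sqrtC x)^-1) _.
have PU : P \is unitarymx by exact: spectral_unitarymx.
rewrite invmx_unitary// !mulmxA -map_mxM -trmx_mul -mulmxA.
set w := P *m u; have /cV0Pn[k wk] : w != 0.
  apply: contra_neq u0 => w0; apply: (can_inj (mulKmx (spectral_unit M))).
  by rewrite -/P -/w w0 mulmx0.
have E i : (w^t* *m diag_mx S) 0 i * w i 0 = S 0 i * `|w i 0| ^+ 2.
  by rewrite mul_mx_diag !mxE normCK; ring.
have S0 i : 0 < S 0 i by rewrite mxE invr_gt0 sqrtC_gt0 D0.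
rewrite mxE (eq_bigr _ (fun i _ => E i)) (bigD1 k)//= ltr_pwDl//.
  by rewrite mulr_gt0// exprn_gt0// normr_gt0.
by apply: sumr_ge0 => i _; rewrite mulr_ge0 ?exprn_ge0// ltW.
Qed.

Lemma invsqrtmx_sqr d (M : 'M[C]_d) :
  posdefmx M -> invsqrtmx M *m invsqrtmx M = invmx M.
Proof.
move=> /posdefmx_spectral[ME D0]; set S := invsqrtmx M.
have PU := spectral_unitarymx M.
suff SSM : S *m S *m M = 1%:M.
  have [_ MU] := mulmx1_unit SSM.
  by rewrite -[LHS](mulmxK MU) SSM mul1mx.
rewrite [in X in _ *m X]ME /S /invsqrtmx -(invmx_unitary PU).
have PI := spectral_unit M.
rewrite !mulmxA (mulmxK PI) (mulmxK PI).
rewrite -!(mulmxA (invmx _)) !mulmx_diag.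
set X := diag_mx _; suff -> : X = 1%:M; first by rewrite mul1mx mulVmx.
rewrite -diag_const_mx; congr diag_mx; apply/rowP => k; rewrite !mxE.
by rewrite -invfM -expr2 sqrtCK mulVf// gt_eqF.
Qed.

Lemma FmapE n p (u : 'cV[C]_(blockdim n p)) (lambda : C) :
  Fmap u lambda = \sum_(i < n.+1) lambda ^+ i *: submxcol u i.
Proof.
rewrite /Fmap -{1}[u]submxcolK /Fmx mul_mxrow_mxcol.
by apply: eq_bigr => i _; rewrite mul_scalar_mx.
Qed.

Lemma Fmap_inj n p : injective (@Fmap R n p).
Proof.
move=> u v uv; rewrite -[u]submxcolK -[v]submxcolK.
apply: eq_mxcol => i; apply/matrixP => k j; rewrite {j}ord1.
pose c i := submxcol u i k 0 - submxcol v i k 0.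
pose q : {poly C} := \poly_(i < n.+1) c (inord i).
have q_ev x : q.[x] = 0.
  rewrite horner_poly; apply: (etrans (y := Fmap u x k 0 - Fmap v x k 0)).
    rewrite !FmapE !summxE -sumrB; apply: eq_bigr => l _.
    by rewrite inord_val /c !mxE; ring.
  by rewrite uv subrr.
have q0 : q = 0.
  apply: (@roots_geq_poly_eq0 _ _ [seq j%:R | j <- iota 0 n.+1]).
  - by apply/allP => x _; apply/rootP; exact: q_ev.
  - by rewrite map_inj_uniq ?iota_uniq// => a b /eqP; rewrite eqr_nat => /eqP.
  - by rewrite size_map size_iota size_poly.
have : q`_i = 0 by rewrite q0 coef0.
by rewrite coef_poly ltn_ord inord_val => /eqP; rewrite subr_eq0 => /eqP.
Qed.

Lemma HcoefE n p (u : 'cV[C]_(blockdim n p)) : Hcoef n (Fmap u) = u.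
Proof. by rewrite /Hcoef; case: xgetP => [v _ /Fmap_inj//|/(_ u)[]]. Qed.

Lemma HdotE n p (G : 'M[C]_(blockdim n p)) (u v : 'cV[C]_(blockdim n p)) :
  Hdot G (Fmap u) (Fmap v) = (v^t* *m G *m u) 0 0.
Proof. by rewrite /Hdot !HcoefE. Qed.

Lemma Rshift_Hspace n p (alpha : C) f :
  Hspace n f -> Hspace n (@Rshift R p alpha f).
Proof.
move=> [u _ <-].
pose v : 'cV[C]_(blockdim n p) := \mxcol_(j < n.+1)
  \sum_(i < n.+1 | (j < i)%N) alpha ^+ (i.-1 - j) *: submxcol u i.
have uv x : Fmap u x - Fmap u alpha = (x - alpha) *: Fmap v x.
  rewrite !FmapE -sumrB scaler_sumr.
  under [RHS]eq_bigr do rewrite /v mxcolK scalerA scaler_sumr big_mkcond.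
  rewrite exchange_big; apply: eq_bigr => i _ /=; rewrite -big_mkcond/=.
  rewrite -scalerBl -opprB subrXX -mulNr opprB mulr_sumr scaler_suml.
  rewrite (big_ord_widen n.+1 (fun j => ((x - alpha) *
    (alpha ^+ (i.-1 - j) * x ^+ j)) *: submxcol u i)) 1?ltnW//.
  by apply: eq_bigr => j _; rewrite scalerA; congr (_ *: _); ring.
exists v => //; apply/funext => x; rewrite /Rshift.
have [->|xa] := eqVneq; last by rewrite uv scalerK// subr_eq0.
rewrite FmapE; by apply/esym/derive1_powers => y; rewrite uv FmapE.
Qed.

Lemma Tmap_Hspace n p (alpha : C) f :
  Hspace n f -> Hspace n (@Tmap R p alpha f).
Proof.
move=> Hf; have [v _ vE] := Rshift_Hspace alpha Hf; have [u _ uE] := Hf.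
exists (u + (alpha - alpha^*) *: v) => //; apply/funext => x.
by rewrite /Tmap -vE -uE /Fmap mulmxDr -scalemxAr.
Qed.

End Adequacy.

(* Main.v *)
Require Import Defs.
From mathcomp Require Import all_boot all_order all_algebra.
From mathcomp Require Import all_classical all_reals all_analysis.
From mathcomp Require Import complex ring.
Import Order.TTheory GRing.Theory Num.Theory.
Import numFieldNormedType.Exports.
Local Open Scope ring_scope.

(** Write A for the block shift, E = F(0), B(a) = I - a A and J = A^* A. Since
    F(l) = l F(l) A + E, one has F(l) B(a) = (l - a) F(l) A + E, so B(a) turns
    evaluation at a into evaluation at 0: F(a) B(a) = E. Moreover E E^* = I, E
    A^* = 0 and J = I - E^* E, so J is the orthogonal projector onto the kernel
    of E, and B(a) maps the range of J onto the kernel of F(a).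

    The matrix N_a is annihilated by F(a) on the left (Fmx_Nmx), hence N_a =
    B(a) W_a B(a)^* with a Hermitian W_a supported on the range of J (Nmx_Nred,
    Fmx0_Nred, Nred_Fmx0). Once this is substituted, both sides of each of the
    three identities in N_a and N_(a^* ) carry the same factors around W_a and
    W_(a^* ): the polynomial (l - a)(l - a^* ) and F(l) A, or the invertible
    product B(a^* ) B(a). These factors separate matrices supported on the
    range of J, so each identity says exactly that W_a = W_(a^* ), for every a
    (N_kernel_identityP, N_row_identityP, N_matrix_identityP).

    On the range of J, the matrix W_a is the inverse of the compression of the
    Gram matrix H_a = B(a)^* G B(a), because N_a G is the projection onto the
    kernel of F(a) that is orthogonal for the inner product defined by G.
    Therefore W_a = W_(a^* ) if and only if J H_a J = J H_(a^* ) J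
    (Nred_eq_gram).

    If E w = 0, then T_a maps F B(a) w to F B(a^* ) w (Tmap_pencil). The
    functions F B(a) w are exactly the elements of H_G that vanish at a, so
    polarization turns the isometry into J H_a J = J H_(a^* ) J as well
    (Tmap_isometryP).

    Expanding the Gram matrices, J (H_a - H_(a^* )) J is a^* - a times A^* (A G
    - G A^* ) A (compressed_gram_diff). For a nonreal, equality of the
    compressions thus means that the last matrix vanishes, and the block of
    that matrix at (i + 1, j + 1) is g_(i+1,j) - g_(i,j+1): its vanishing is
    the block Hankel property (block_hankelP). *)

(** * Conjugate transposes and positive definite matrices *)

Section ConjugateTranspose.
Set Implicit Arguments.
Unset Strict Implicit.
Local Open Scope sesquilinear_scope.
Variable C : numClosedFieldType.

Lemma conjtr_mul q r s (M : 'M[C]_(q, r)) (N : 'M[C]_(r, s)) :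
  (M *m N)^t* = N^t* *m M^t*.
Proof. by rewrite trmx_mul map_mxM. Qed.

Lemma conjtrB q r (M N : 'M[C]_(q, r)) : (M - N)^t* = M^t* - N^t*.
Proof. by rewrite linearB map_mxB. Qed.

Lemma conjtrD q r (M N : 'M[C]_(q, r)) : (M + N)^t* = M^t* + N^t*.
Proof. by rewrite linearD map_mxD. Qed.

Lemma conjtrZ q r c (M : 'M[C]_(q, r)) : (c *: M)^t* = c^* *: M^t*.
Proof. by rewrite linearZ map_mxZ. Qed.

Lemma conjtr1 q : (1%:M : 'M[C]_q)^t* = 1%:M.
Proof. by rewrite trmx1 map_mx1. Qed.

Lemma conjtr_inv q (M : 'M[C]_q) : (invmx M)^t* = invmx (M^t*).
Proof. by rewrite trmx_inv map_invmx. Qed.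

(** Polarization: over a field containing the imaginary unit, the values of the
    form at x + y and at x + i y determine its off-diagonal values, even when D
    is not Hermitian. *)
Lemma quadratic_form_eq0 q (D : 'M[C]_q) :
  (forall u : 'cV[C]_q, (u^t* *m D *m u) 0 0 = 0) -> D = 0.
Proof.
move=> D0.
have bil (x y : 'cV[C]_q) (c : C) :
    c * (x^t* *m D *m y) 0 0 + c^* * (y^t* *m D *m x) 0 0 = 0.
  have := D0 (x + c *: y).
  rewrite conjtrD conjtrZ mulmxDl mulmxDr !mulmxDl.
  rewrite -!scalemxAl -!scalemxAr ![fun_of_matrix (_ + _) _ _]mxE.
  rewrite ![fun_of_matrix (_ *: _) _ _]mxE !D0.
  by rewrite !mulr0 add0r addr0 addrC.
apply/matrixP => i j; rewrite [RHS]mxE.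
have := bil (delta_mx i 0) (delta_mx j 0) 1.
have := bil (delta_mx i 0) (delta_mx j 0) 'i.
rewrite conjC1 conjCi !mul1r mulNr -mulrBr => /eqP.
rewrite mulf_eq0 (negPf (neq0Ci _)) /= subr_eq0 => /eqP <- /eqP.
rewrite -mulr2n mulrn_eq0 /= => /eqP.
by rewrite trmx_delta map_delta_mx -rowE -colE !mxE.
Qed.

End ConjugateTranspose.

Section PositiveDefiniteInverse.
Set Implicit Arguments.
Unset Strict Implicit.
Local Open Scope sesquilinear_scope.
Variable R : realType.
Local Notation C := R[i].

Lemma posdefmx_unit q (M : 'M[C]_q) : posdefmx M -> M \in unitmx.
Proof.
move=> M_pos; rewrite -row_full_unit -cokermx_eq0; apply/eqP.
apply/matrixP => i j; rewrite [RHS]mxE.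
pose u := cokermx M *m (delta_mx j 0 : 'cV_q).
have [u0|/M_pos] := eqVneq u 0.
  by move/matrixP/(_ i 0): u0; rewrite /u -colE !mxE.
by rewrite /u -mulmxA (mulmxA M) mulmx_coker mul0mx mulmx0 mxE ltxx.
Qed.

Lemma posdefmx_inv q (M : 'M[C]_q) : posdefmx M -> posdefmx (invmx M).
Proof.
move=> M_pos u u0; have Mu := posdefmx_unit M_pos.
have /M_pos : invmx M *m u != 0.
  by apply: contra_neq u0 => Mu0; rewrite -[u](mulKVmx Mu) Mu0 mulmx0.
rewrite conjtr_mul conjtr_inv posdefmx_hermitian//.
by rewrite -!mulmxA (mulKVmx Mu).
Qed.

End PositiveDefiniteInverse.

(** * The shift and the evaluation matrices *)

Section Shift.
Set Implicit Arguments.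
Unset Strict Implicit.
Local Open Scope sesquilinear_scope.
Variables (R : realType) (n p : nat).
Local Notation C := R[i].
Local Notation m := (blockdim n p).
Local Notation F := (Fmx n p).
Local Notation A := (shiftmx R n p).
Local Notation E := (Fmx n p (0 : C)).
Local Notation B a := (1%:M - a *: A).

(** The coefficients of the polynomial F X are the blocks of X, and a product
    of polynomials with a nonzero factor q vanishes only if the other factor
    does. The factor q allows the identity F(l) X = 0 to be known only off the
    roots of q. *)
Lemma Fmx_separates k (q : {poly C}) (X : 'M[C]_(m, k)) :
  q != 0 -> (forall lambda, q.[lambda] *: (F lambda *m X) = 0) -> X = 0.
Proof.
move=> q0 qX; rewrite -[X]submxcolK -[RHS]submxcolK.
apply: eq_mxcol => i; rewrite submxcol0; apply/matrixP => a b; rewrite [RHS]mxE.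
pose c i := submxcol X i a b.
pose r : {poly C} := \poly_(i < n.+1) c (inord i).
have qr_ev x : (q * r).[x] = 0.
  transitivity ((q.[x] *: (F x *m X)) a b); last by rewrite qX mxE.
  rewrite hornerM horner_poly -[X in _ *m X]submxcolK /Fmx mul_mxrow_mxcol mxE.
  congr (_ * _); rewrite summxE; apply: eq_bigr => l _.
  by rewrite inord_val mul_scalar_mx mxE mulrC.
have /eqP : q * r = 0.
  apply: (@roots_geq_poly_eq0 _ _ [seq j%:R | j <- iota 0 (size (q * r))]).
  - by apply/allP => x _; apply/rootP; exact: qr_ev.
  - by rewrite map_inj_uniq ?iota_uniq// => x y /eqP; rewrite eqr_nat => /eqP.
  - by rewrite size_map size_iota.
rewrite mulf_eq0 (negPf q0) /= => /eqP r0.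
have : r`_i = 0 by rewrite r0 coef0.
by rewrite coef_poly ltn_ord inord_val.
Qed.

Lemma shiftmx_conj : A^t* = A^T.
Proof.
apply/matrixP => i j; rewrite !mxE /=.
by case: ifP => _; rewrite !mxE ?conjC_nat ?conjC0.
Qed.

Lemma submxblock_shiftMl (X : 'M[C]_m) (i j : 'I_n.+1) :
  submxblock (A *m X) i j =
  \sum_(k < n.+1 | k == i.+1 :> nat) submxblock X k j.
Proof.
rewrite -{1}[X]submxblockK /shiftmx mul_mxblock mxblockK [RHS]big_mkcond.
by apply: eq_bigr => k _; case: ifP => _; rewrite ?mul1mx ?mul0mx.
Qed.

Lemma submxblock_shiftMr (X : 'M[C]_m) (i j : 'I_n.+1) :
  submxblock (X *m A) i j =
  \sum_(k < n.+1 | j == k.+1 :> nat) submxblock X i k.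
Proof.
rewrite -{1}[X]submxblockK /shiftmx mul_mxblock mxblockK [RHS]big_mkcond.
by apply: eq_bigr => k _; case: ifP => _; rewrite ?mulmx1 ?mulmx0.
Qed.

Lemma shiftmx_tr :
  A^T = \mxblock_(i < n.+1, j < n.+1)
          (if i == j.+1 :> nat then 1%:M else 0 : 'M[C]_p).
Proof.
rewrite /shiftmx tr_mxblock; apply: eq_mxblock => i j.
by case: ifP; rewrite ?trmx1 ?trmx0.
Qed.

Lemma submxblock_trshiftMl (X : 'M[C]_m) (i j : 'I_n.+1) :
  submxblock (A^T *m X) i j =
  \sum_(k < n.+1 | i == k.+1 :> nat) submxblock X k j.
Proof.
rewrite -{1}[X]submxblockK shiftmx_tr mul_mxblock mxblockK [RHS]big_mkcond.
by apply: eq_bigr => k _; case: ifP => _; rewrite ?mul1mx ?mul0mx.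
Qed.

Lemma submxblock_trshiftMr (X : 'M[C]_m) (i j : 'I_n.+1) :
  submxblock (X *m A^T) i j =
  \sum_(k < n.+1 | k == j.+1 :> nat) submxblock X i k.
Proof.
rewrite -{1}[X]submxblockK shiftmx_tr mul_mxblock mxblockK [RHS]big_mkcond.
by apply: eq_bigr => k _; case: ifP => _; rewrite ?mulmx1 ?mulmx0.
Qed.

Lemma Fmx0E :
  E = \mxrow_(i < n.+1) (if i == 0%N :> nat then 1%:M else 0 : 'M[C]_p).
Proof.
apply: eq_mxrow => i; rewrite expr0n; case: eqP => // _.
by apply/matrixP => a b; rewrite !mxE mul0rn.
Qed.

Lemma Fmx0_conj : E^t* = E^T.
Proof.
rewrite Fmx0E; apply/matrixP => i j; rewrite !mxE.
by case: ifP => _; rewrite !mxE ?conjC_nat ?conjC0.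
Qed.

Lemma Fmx0_coisometry : E *m E^T = 1%:M.
Proof.
rewrite Fmx0E tr_mxrow mul_mxrow_mxcol (bigD1 ord0)//= trmx1 mulmx1.
by rewrite big1 ?addr0// => i /negPf i0; rewrite -val_eqE /= in i0;
  rewrite i0 mul0mx.
Qed.

(** Horner's rule. *)
Lemma Fmx_shift lambda : F lambda = lambda *: (F lambda *m A) + E.
Proof.
rewrite Fmx0E scalemxAl -mul_scalar_mx /Fmx mul_mxrow /shiftmx.
rewrite mul_mxrow_mxblock -mxrowD; apply: eq_mxrow => -[[|j] jlt] /=.
  by rewrite expr0 big1 ?add0r// => i _; rewrite mulmx0.
rewrite addr0 (bigD1 (Ordinal (ltnW jlt)))//= eqxx mulmx1 -scalar_mxM -exprS.
rewrite big1 ?addr0// => i /negPf; rewrite -val_eqE /= eqSS eq_sym => ->.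
by rewrite mulmx0.
Qed.

Lemma Fmx0_trshift : E *m A^T = 0.
Proof.
rewrite Fmx0E shiftmx_tr mul_mxrow_mxblock -[RHS]submxrowK.
apply: eq_mxrow => j; rewrite submxrow0 big1// => i _.
by case: eqP => [->|_]; rewrite ?mul0mx // mulmx0.
Qed.

(** The shift is a partial isometry that forgets exactly the block of index 0,
    which is the block that E reads. *)
Lemma shift_projector : A^T *m A = 1%:M - E^T *m E.
Proof.
rewrite Fmx0E tr_mxrow mul_mxcol_mxrow.
apply/mxblockP => i j; rewrite submxblockB mxblockK -mxdiagZ /mxdiag mxblockK.
rewrite submxblock_trshiftMl /shiftmx.
under eq_bigr do rewrite mxblockK.
case: i j => -[|i] ilt [[|j] jlt]; rewrite -!val_eqE /= ?conform_mx_id.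
- by rewrite trmx1 mulmx1 subrr big_pred0.
- by rewrite mulmx0 subr0 big_pred0.
- rewrite trmx0 mul0mx subr0 big1// => k _; by case: eqP.
- rewrite mulmx0 subr0 (bigD1 (Ordinal (ltnW ilt)))//= big1 ?addr0.
    by rewrite [j.+1 == _]eq_sym.
  by move=> k /andP[/eqP[ki]]; rewrite -val_eqE /= ki eqxx.
Qed.

Lemma shift_kernel k (X : 'M[C]_(m, k)) : E *m X = 0 -> A *m X = 0 -> X = 0.
Proof.
move=> EX AX; have := mul1mx X.
rewrite -[1%:M](subrK (E^T *m E)) -shift_projector mulmxDl -!mulmxA EX AX.
by rewrite !mulmx0 addr0.
Qed.

(** The two cases that matter are lambda = a, where the right-hand side is E,
    and a right factor killed by E, where it is divisible by lambda - a. *)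
Lemma Fmx_pencil lambda a :
  F lambda *m B a = (lambda - a) *: (F lambda *m A) + E.
Proof.
rewrite mulmxBr mulmx1 -scalemxAr scalerBl [X in X - _]Fmx_shift.
by rewrite addrAC.
Qed.

(** The pencil is invertible because A is nilpotent. The proof uses evaluation
    instead of powers of A: if B(a) X = 0, then (l - a) F(l) A X + E X = 0 for
    all l, so l = a gives E X = 0, then A X = 0, and X = a A X = 0. *)
Lemma pencil_unit a : B a \in unitmx.
Proof.
rewrite -row_full_unit -cokermx_eq0; apply/eqP.
have : B a *m cokermx (B a) = 0 by exact: mulmx_coker.
move: (cokermx _) => X BX.
have FX lambda : (lambda - a) *: (F lambda *m (A *m X)) + E *m X = 0.
  by rewrite mulmxA scalemxAl -mulmxDl -Fmx_pencil -mulmxA BX mulmx0.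
have EX : E *m X = 0 by have := FX a; rewrite subrr scale0r add0r.
have AX : A *m X = 0.
  apply: (@Fmx_separates _ ('X - a%:P)); first by rewrite polyXsubC_eq0.
  by move=> lambda; have := FX lambda; rewrite EX addr0 hornerXsubC.
by move: BX; rewrite mulmxBl mul1mx -scalemxAl AX scaler0 subr0.
Qed.

Lemma pencil_comm a b : B a *m B b = B b *m B a.
Proof.
rewrite !mulmxBl !mulmxBr !mul1mx !mulmx1 -!scalemxAl -!scalemxAr.
rewrite !scalerA [a * b]mulrC !opprB !addrA [LHS]addrAC [RHS]addrAC.
by congr (_ + _); exact: addrAC.
Qed.

Lemma pencil_conjtr a : (B a)^t* = 1%:M - a^* *: A^T.
Proof. by rewrite conjtrB conjtr1 conjtrZ shiftmx_conj. Qed.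

End Shift.

(** * The reduced matrix as the inverse of a compressed Gram matrix *)

Section CompressionInverse.
Set Implicit Arguments.
Unset Strict Implicit.

(** The hypotheses say that W1 and W2 are the inverses of the compressions J H1
    J and J H2 J in the corner ring J M J, whose unit is J. *)
Lemma compression_inverse_eq (K : pzRingType) q (J W1 W2 H1 H2 : 'M[K]_q) :
  J *m J = J -> J *m W1 = W1 -> W1 *m J = W1 -> J *m W2 = W2 -> W2 *m J = W2 ->
  W1 *m H1 *m J = J -> W2 *m H2 *m J = J ->
  J *m (H1 *m W1) = J -> J *m (H2 *m W2) = J ->
  W1 = W2 <-> J *m H1 *m J = J *m H2 *m J.
Proof.
move=> JJ JW1 W1J JW2 W2J WH1 WH2 HW1 HW2; split=> [W12|H12].
  by rewrite -{1}HW2 -W12 -!mulmxA [W1 *m (_ *m _)]mulmxA WH1.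
have -> : W1 = W2 *m (J *m H2 *m J) *m W1 by rewrite !mulmxA W2J WH2 JW1.
by rewrite -H12 -!mulmxA JW1 HW1 W2J.
Qed.

End CompressionInverse.

Section Compression.
Set Implicit Arguments.
Unset Strict Implicit.
Local Open Scope sesquilinear_scope.
Variables (R : realType) (n p : nat).
Local Notation C := R[i].
Local Notation m := (blockdim n p).
Local Notation F := (Fmx n p).
Local Notation A := (shiftmx R n p).
Local Notation E := (Fmx n p (0 : C)).
Local Notation B a := (1%:M - a *: A).
Local Notation J := (A^T *m A).
Variable G : 'M[C]_m.
Hypothesis G_pos : posdefmx G.
Local Notation N := (Nmx G).

Definition pencil_gram a : 'M[C]_m := (B a)^t* *m G *m B a.
(** Nred a is the matrix W_a with N_a = B(a) W_a B(a)^*. *)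
Definition Nred a : 'M[C]_m := invmx (B a) *m N a *m (invmx (B a))^t*.
Local Notation H := pencil_gram.
Local Notation W := Nred.

Let G_herm : G^t* = G := posdefmx_hermitian G_pos.

Let G_unit : G \in unitmx := posdefmx_unit G_pos.

(** F(a) has full row rank, since F(a) B(a) = E and E E^* = I. *)
Lemma Fmx_gram_posdef a : posdefmx (F a *m invmx G *m (F a)^t*).
Proof.
move=> u u0; have /(posdefmx_inv G_pos) : (F a)^t* *m u != 0.
  apply: contra_neq u0 => Fu0.
  have EF : E = F a *m B a by rewrite Fmx_pencil subrr scale0r add0r.
  rewrite -[u]mul1mx -(Fmx0_coisometry R n p) -Fmx0_conj -mulmxA.
  by rewrite [in X in _ *m X]EF conjtr_mul -mulmxA Fu0 !mulmx0.
by rewrite conjtr_mul trmxCK !mulmxA.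
Qed.

Lemma NmxE a : N a = invmx G - invmx G *m (F a)^t*
    *m invmx (F a *m invmx G *m (F a)^t*) *m F a *m invmx G.
Proof.
have M_pos := Fmx_gram_posdef a.
have := posdefmx_hermitian (invsqrtmx_posdef M_pos).
rewrite /Nmx /zmx -(invsqrtmx_sqr M_pos); move: (invsqrtmx _) => S S_herm.
by rewrite !conjtr_mul trmxCK conjtr_inv G_herm S_herm !mulmxA.
Qed.

Lemma Nmx_herm a : (N a)^t* = N a.
Proof.
by rewrite /Nmx conjtrB conjtr_mul trmxCK conjtr_inv G_herm.
Qed.

Lemma Fmx_Nmx a : F a *m N a = 0.
Proof.
rewrite NmxE mulmxBr !mulmxA mulmxV ?mul1mx ?subrr//.
exact/posdefmx_unit/Fmx_gram_posdef.
Qed.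

Lemma Nmx_Nred a : N a = B a *m W a *m (B a)^t*.
Proof.
have U := pencil_unit n p a.
rewrite /Nred !mulmxA mulmxV// mul1mx -mulmxA -conjtr_mul mulmxV//.
by rewrite conjtr1 mulmx1.
Qed.

Lemma Fmx_inv_pencil a : E *m invmx (B a) = F a.
Proof.
have -> : E = F a *m B a by rewrite Fmx_pencil subrr scale0r add0r.
by rewrite mulmxK// pencil_unit.
Qed.

Lemma Nred_herm a : (W a)^t* = W a.
Proof. by rewrite /Nred !conjtr_mul trmxCK Nmx_herm mulmxA. Qed.

Lemma Fmx0_Nred a : E *m W a = 0.
Proof. by rewrite /Nred !mulmxA Fmx_inv_pencil Fmx_Nmx mul0mx. Qed.

Lemma Nred_Fmx0 a : W a *m E^t* = 0.
Proof.
by rewrite -[W a]Nred_herm -conjtr_mul Fmx0_Nred trmx0 map_mx0.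
Qed.

Lemma Fmx0_projector : E *m J = 0.
Proof.
by rewrite shift_projector mulmxBr mulmx1 mulmxA Fmx0_coisometry mul1mx subrr.
Qed.

Lemma projector_Nred a : J *m W a = W a.
Proof.
by rewrite shift_projector mulmxBl mul1mx -mulmxA Fmx0_Nred mulmx0 subr0.
Qed.

Lemma projector_herm : J^t* = J.
Proof.
have := trmxCK A; rewrite shiftmx_conj => ATC.
by rewrite conjtr_mul ATC shiftmx_conj.
Qed.

Lemma Nred_projector a : W a *m J = W a.
Proof.
by rewrite -[W a]Nred_herm -projector_herm -conjtr_mul projector_Nred.
Qed.

Lemma gram_herm a : (H a)^t* = H a.
Proof. by rewrite /pencil_gram !conjtr_mul trmxCK G_herm mulmxA. Qed.

(** The shape of N_a G is all that matters below: it is the identity on the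
    kernel of F(a). *)
Lemma Nmx_mulG a : exists X, N a *m G = 1%:M - X *m F a.
Proof.
rewrite NmxE; move: (invmx _ *m _ *m invmx _) => X; exists X.
by rewrite mulmxBl mulVmx// mulmxKV.
Qed.

(** The factors B(a) cancel in W_a H_a, which becomes the conjugate of N_a G by
    B(a); since F(a) B(a) J = E J = 0, N_a G fixes the columns of B(a) J. *)
Lemma Nred_gram a : W a *m H a *m J = J.
Proof.
have BJ : invmx (B a) *m (B a *m J) = J by rewrite mulKmx// pencil_unit.
have FBJ : F a *m (B a *m J) = 0.
  by rewrite mulmxA Fmx_pencil subrr scale0r add0r Fmx0_projector.
have UV : (invmx (B a))^t* *m (B a)^t* = 1%:M.
  by rewrite -conjtr_mul mulmxV ?conjtr1// pencil_unit.
have [X NG] := Nmx_mulG a; rewrite /Nred /pencil_gram.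
move: ((B a)^t*) ((invmx (B a))^t*) UV => V U UV.
move: (invmx (B a)) (B a) J BJ FBJ => iB b K BJ FBJ.
rewrite -!mulmxA (mulmxA U) UV mul1mx (mulmxA (N a)) NG.
by rewrite mulmxBl mul1mx -mulmxA FBJ mulmx0 subr0.
Qed.

Lemma projector_idem : J *m J = J.
Proof.
rewrite {1}shift_projector mulmxBl mul1mx -mulmxA Fmx0_projector.
by rewrite mulmx0 subr0.
Qed.

Lemma gram_Nred a : J *m (H a *m W a) = J.
Proof.
have := Nred_gram a; have := projector_herm.
move: J (W a) (H a) (Nred_herm a) (gram_herm a) => K V M VH MH KH.
by move=> /(congr1 (fun M => M^t*)); rewrite !conjtr_mul KH VH MH.
Qed.

Lemma Nred_eq_gram a b : W a = W b <-> J *m H a *m J = J *m H b *m J.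
Proof.
exact: (compression_inverse_eq projector_idem (projector_Nred a)
  (Nred_projector a) (projector_Nred b) (Nred_projector b)
  (Nred_gram a) (Nred_gram b) (gram_Nred a) (gram_Nred b)).
Qed.

End Compression.

(** * The three identities for the matrices N *)

Section NIdentities.
Set Implicit Arguments.
Unset Strict Implicit.
Local Open Scope sesquilinear_scope.
Variables (R : realType) (n p : nat).
Local Notation C := R[i].
Local Notation m := (blockdim n p).
Local Notation F := (Fmx n p).
Local Notation A := (shiftmx R n p).
Local Notation E := (Fmx n p (0 : C)).
Local Notation B a := (1%:M - a *: A).

Lemma conj_pencil a b : b^* = a -> 1%:M - a *: A^t* = (B b)^t*.
Proof. by move=> <-; rewrite conjtrB conjtr1 conjtrZ. Qed.

Lemma polyXsubC_mul_neq0 (a b : C) : ('X - a%:P) * ('X - b%:P) != 0.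
Proof. by rewrite mulf_neq0// polyXsubC_eq0. Qed.

#[local] Opaque shiftmx Fmx Nmx Nred invmx.
Variable G : 'M[C]_m.
Hypothesis G_pos : posdefmx G.
Local Notation N := (Nmx G).
Local Notation W := (Nred G).

Lemma Fmx_pencil_Nred lambda a :
  F lambda *m (B a *m W a) = (lambda - a) *: (F lambda *m A *m W a).
Proof.
rewrite mulmxA Fmx_pencil mulmxDl (Fmx0_Nred G_pos a).
by rewrite addr0 -scalemxAl.
Qed.

Lemma Nred_pencil_Fmx omega a :
  W a *m ((B a)^t* *m (F omega)^t*) =
  (omega^* - a^*) *: (W a *m (F omega *m A)^t*).
Proof.
have := congr1 (fun M => M^t*) (Fmx_pencil_Nred omega a).
rewrite -rmorphB; have := Nred_herm G_pos a.
move: (W a) (B a) => V b VH; rewrite conjtrZ mulmxA.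
by rewrite conjtr_mul [in RHS]conjtr_mul conjtr_mul VH.
Qed.

Lemma N_kernelE lambda omega a :
  F lambda *m N a *m (F omega)^t* = ((lambda - a) * (omega^* - a^*)) *:
    (F lambda *m A *m W a *m (F omega *m A)^t*).
Proof.
have L := Fmx_pencil_Nred lambda a; have M := Nred_pencil_Fmx omega a.
rewrite (Nmx_Nred G a) mulmxA -mulmxA L -scalemxAl -(mulmxA (F lambda *m A)).
by rewrite M -scalemxAr scalerA mulmxA.
Qed.

Lemma N_rowE lambda a b : b^* = a ->
  F lambda *m N a *m (1%:M - a *: A^t*) = (lambda - a) *:
    (F lambda *m A *m W a *m (B b *m B a)^t*).
Proof.
move=> ba; have L := Fmx_pencil_Nred lambda a.
rewrite [X in _ *m X = _](conj_pencil ba) (Nmx_Nred G a) (mulmxA (F lambda)).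
rewrite L -scalemxAl -scalemxAl conjtr_mul.
by move: (_ *m W a) => X; rewrite mulmxA.
Qed.

Lemma N_matrixE a b : b^* = a ->
  (1%:M - b *: A) *m N a *m (1%:M - a *: A^t*) =
    (B b *m B a) *m W a *m (B b *m B a)^t*.
Proof.
move=> ba; rewrite [X in _ *m X = _](conj_pencil ba) (Nmx_Nred G a) conjtr_mul.
by move: (B a) (B b) => X Y; rewrite !mulmxA.
Qed.

(** The block row of index 0, which A forgets, is zero in every W_a. *)
Lemma Nred_shift_inj a b :
  A *m (W a - W b) = 0 -> W a = W b.
Proof.
move=> AD; apply/eqP; rewrite -subr_eq0; apply/eqP.
apply: shift_kernel AD.
by rewrite mulmxBr (Fmx0_Nred G_pos a) (Fmx0_Nred G_pos b) subrr.
Qed.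

Lemma N_kernel_conjE lambda omega a b : b^* = a ->
  ((lambda - b) * (omega^* - a)) *: (F lambda *m N a *m (F omega)^t*) =
  ((lambda - a) * (lambda - b) * ((omega - a) * (omega - b))^*) *:
    (F lambda *m A *m W a *m (F omega *m A)^t*).
Proof.
move=> ba; rewrite N_kernelE scalerA rmorphM !rmorphB/= ba.
by congr (_ *: _); ring.
Qed.

Lemma Nred_diff_Fmx0 a b : (W a - W b) *m E^t* = 0.
Proof.
by rewrite mulmxBl (Nred_Fmx0 G_pos a) (Nred_Fmx0 G_pos b) subrr.
Qed.

Lemma shift_compression_inj (X : 'M[C]_m) :
  X *m E^t* = 0 -> A *m (A *m X)^t* = 0 -> A *m X = 0.
Proof.
move=> XE AXA; suff AXh : (A *m X)^t* = 0.
  by rewrite -[LHS]trmxCK AXh trmx0 map_mx0.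
apply: shift_kernel AXA; have := congr1 (fun M => M^t*) XE.
move: E A => e S; rewrite !conjtr_mul trmxCK trmx0 map_mx0 mulmxA => ->.
by rewrite mul0mx.
Qed.

(** By N_kernel_conjE both sides have the factor q(lambda) q(omega)^*, where
    q(x) = (x - a)(x - a^* ) is symmetric in a and a^*. Equality for all lambda
    and omega therefore leaves A (W_a - W_(a^* )) A^* = 0, and the two factors
    A can be removed because E annihilates the difference from both sides. *)
Lemma N_kernel_identityP a : N_kernel_identity G a <-> W a = W a^*.
Proof.
rewrite /N_kernel_identity; have := conjCK a; have := erefl (a^*).
(* With b in place of the conjugate of a, the two sides of the identity are
   exchanged by swapping a and b, since b^* = a and a^* = b. *)
move: {-1}(a^*) => b ab ba.
pose q : {poly C} := ('X - a%:P) * ('X - b%:P).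
have q0 : q != 0 := polyXsubC_mul_neq0 a b.
have qE x : q.[x] = (x - a) * (x - b) by rewrite hornerM !hornerXsubC.
have qE' x : q.[x] = (x - b) * (x - a) by rewrite (qE x) mulrC.
have kE lambda omega : ((lambda - b) * (omega^* - a)) *:
    (F lambda *m N a *m (F omega)^t*) = (q.[lambda] * (q.[omega])^*) *:
    (F lambda *m A *m W a *m (F omega *m A)^t*).
  by rewrite (qE lambda) (qE omega); exact: N_kernel_conjE.
have kE' lambda omega : ((lambda - a) * (omega^* - b)) *:
    (F lambda *m N b *m (F omega)^t*) = (q.[lambda] * (q.[omega])^*) *:
    (F lambda *m A *m W b *m (F omega *m A)^t*).
  by rewrite (qE' lambda) (qE' omega); exact: N_kernel_conjE.
split=> [kerN|Wa lambda omega]; last first.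
  by apply: (etrans (kE _ _)); apply: etrans (esym (kE' _ _)); rewrite Wa.
apply: Nred_shift_inj; apply: shift_compression_inj.
  exact: Nred_diff_Fmx0.
apply: (Fmx_separates q0) => omega.
have FF : (q.[omega])^* *: (A *m (W a - W b) *m (F omega *m A)^t*) = 0.
  apply: (Fmx_separates q0) => lambda.
  have := etrans (esym (kE lambda omega)) (etrans (kerN _ _) (kE' _ _)).
  move: (F omega *m A) (F lambda) (W a) (W b) A => X Y V V' S.
  move: q.[lambda] (q.[omega])^* => c d /eqP.
  rewrite -subr_eq0 -scalerBr -mulmxBl -mulmxBr => /eqP.
  by rewrite -scalemxAr scalerA !mulmxA.
have := congr1 (fun M => M^t*) FF; move: (A *m (W a - W b)) => X.
by rewrite conjtrZ conjCK conjtr_mul trmxCK trmx0 map_mx0 mulmxA.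
Qed.

(** Here the factors around W_a are q(lambda) F(lambda) A, with q as for the
    kernel identity, and the conjugate transpose of B(a^* ) B(a), which is
    invertible and symmetric in a and a^*. *)
Lemma N_row_identityP a : N_row_identity G a <-> W a = W a^*.
Proof.
rewrite /N_row_identity; have := conjCK a; have := erefl (a^*).
move: {-1}(a^*) => b ab ba.
pose q : {poly C} := ('X - a%:P) * ('X - b%:P).
have q0 : q != 0 := polyXsubC_mul_neq0 a b.
have qE x : q.[x] = (x - a) * (x - b) by rewrite hornerM !hornerXsubC.
have qE' x : q.[x] = (x - b) * (x - a) by rewrite (qE x) mulrC.
pose Q := (B b *m B a)^t*.
have Q_unit : Q \in unitmx.
  by rewrite map_unitmx unitmx_tr unitmx_mul !pencil_unit.
have rE lambda : (lambda - b) *: (F lambda *m N a *m (1%:M - a *: A^t*)) =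
    q.[lambda] *: (F lambda *m (A *m W a *m Q)).
  rewrite (qE' lambda) -scalerA; congr (_ *: _).
  rewrite (N_rowE lambda ba) -/Q; congr (_ *: _).
  by move: (W a) => X; rewrite !mulmxA.
have rE' lambda : (lambda - a) *: (F lambda *m N b *m (1%:M - b *: A^t*)) =
    q.[lambda] *: (F lambda *m (A *m W b *m Q)).
  rewrite (qE lambda) -scalerA; congr (_ *: _).
  rewrite (N_rowE lambda ab) (pencil_comm n p a b) -/Q; congr (_ *: _).
  by move: (W b) => X; rewrite !mulmxA.
split=> [rowN|Wa lambda]; last first.
  by apply: (etrans (rE _)); apply: etrans (esym (rE' _)); rewrite Wa.
apply: Nred_shift_inj; apply: (can_inj (mulmxK Q_unit)); rewrite mul0mx.
apply: (Fmx_separates q0) => lambda.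
have := etrans (esym (rE lambda)) (etrans (rowN _) (rE' _)).
move: (F lambda) (W a) (W b) A Q q.[lambda] {rE rE' Q_unit}.
move=> Y V V' S M c /eqP.
by rewrite -subr_eq0 -scalerBr -mulmxBr -mulmxBl -mulmxBr => /eqP.
Qed.

Lemma N_matrix_identityP a : N_matrix_identity G a <-> W a = W a^*.
Proof.
rewrite /N_matrix_identity; have := conjCK a; have := erefl (a^*).
move: {-1}(a^*) => b ab ba.
have U : B b *m B a \in unitmx by rewrite unitmx_mul !pencil_unit.
have Uh : (B b *m B a)^t* \in unitmx by rewrite map_unitmx unitmx_tr.
have Ea := N_matrixE ba; have Eb := N_matrixE ab.
rewrite (pencil_comm n p a b) in Eb.
apply: (iff_trans (B := (B b *m B a) *m W a *m (B b *m B a)^t* =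
                        (B b *m B a) *m W b *m (B b *m B a)^t*)).
  split=> Wab; first exact: etrans (esym Ea) (etrans Wab Eb).
  exact: etrans Ea (etrans Wab (esym Eb)).
move: (B b *m B a) U Uh {Ea Eb} => P U Uh; split=> [|->//].
by move=> /(can_inj (mulmxK Uh))/(can_inj (mulKmx U)).
Qed.

End NIdentities.

(** * The isometry and the block Hankel property *)

Section CompressedGram.
Set Implicit Arguments.
Unset Strict Implicit.

(** The terms G and a b S G T cancel in the difference of the two middle
    factors, which leaves (b - a) (G T - S G); the relations between S and T
    then absorb the outer factors S T. For the block shift, S = T^*. *)
Lemma compressed_gram_diff (K : comNzRingType) q (G : 'M[K]_q) (a b : K)
    (S T : 'M[K]_q) :
  T *m (S *m T) = T -> S *m T *m S = S ->
  S *m T *m ((1%:M - b *: S) *m G *m (1%:M - a *: T)) *m (S *m T)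
    - S *m T *m ((1%:M - a *: S) *m G *m (1%:M - b *: T)) *m (S *m T)
  = (b - a) *: (S *m (T *m G - G *m S) *m T).
Proof.
move=> TST STS; rewrite -mulmxBl -mulmxBr.
have -> : (1%:M - b *: S) *m G *m (1%:M - a *: T)
    - (1%:M - a *: S) *m G *m (1%:M - b *: T) = (b - a) *: (G *m T - S *m G).
  rewrite !mulmxBl !mulmxBr !mulmx1 !mul1mx -!scalemxAl -!scalemxAr !scalerA.
  move: (G *m T) (S *m G) (S *m G *m T) => P Q U.
  by apply/matrixP => i j; rewrite !mxE; ring.
rewrite -scalemxAr -scalemxAl mulmxBr mulmxBl mulmxBr mulmxBl.
congr (_ *: (_ - _)); first by rewrite -!mulmxA TST.
by rewrite [S *m T *m (S *m G)]mulmxA STS !mulmxA.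
Qed.

End CompressedGram.

Section Isometry.
Set Implicit Arguments.
Unset Strict Implicit.
Local Open Scope sesquilinear_scope.
Variables (R : realType) (n p : nat).
Local Notation C := R[i].
Local Notation m := (blockdim n p).
Local Notation F := (Fmx n p).
Local Notation A := (shiftmx R n p).
Local Notation E := (Fmx n p (0 : C)).
Local Notation B a := (1%:M - a *: A).
Local Notation J := (A^T *m A).
#[local] Opaque shiftmx Fmx Nred invmx.
Variable G : 'M[C]_m.
Local Notation H := (pencil_gram G).

(** Formally T_a F u = F B(a^* ) B(a)^-1 u. When E w = 0, f = F B(a) w
    satisfies f(l) = (l - a) F(l) A w, so (R_a f)(l) = F(l) A w for l <> a, and
    (l - a) + (a - a^* ) = l - a^*. Since T_a f lies in H_G, it is a polynomial
    and is determined by its values at l <> a, so that f'(a) is not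
    computed. *)
Lemma Tmap_pencil a (w : 'cV[C]_m) : E *m w = 0 ->
  Tmap a (Fmap (B a *m w)) = Fmap (B a^* *m w).
Proof.
move=> Ew; have [|v _ vE] := @Tmap_Hspace R n p a (Fmap (B a *m w)).
  by exists (B a *m w).
rewrite -vE; congr Fmap; apply/eqP; rewrite -subr_eq0; apply/eqP.
have q0 : 'X - a%:P != 0 by rewrite polyXsubC_eq0.
have FB lambda c :
    F lambda *m (B c *m w) = (lambda - c) *: (F lambda *m A *m w).
  by rewrite mulmxA Fmx_pencil mulmxDl Ew addr0 -scalemxAl.
apply: (Fmx_separates q0) => lambda; rewrite hornerXsubC.
have [->|la] := eqVneq lambda a; first by rewrite subrr scale0r.
have la0 : lambda - a != 0 by rewrite subr_eq0.
have Fv : F lambda *m v = Fmap (B a *m w) lambda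
    + (a - a^*) *: Rshift a (Fmap (B a *m w)) lambda.
  by rewrite -[LHS]/(Fmap v lambda) vE.
have Rw : Rshift a (Fmap (B a *m w)) lambda = F lambda *m A *m w.
  have fl := FB lambda a; have fa := FB a a; rewrite -!/(Fmap _ _) in fl fa.
  rewrite (subrr a) scale0r in fa; move: (Fmap _) fl fa => f fl fa.
  rewrite /Rshift (negPf la) fl fa subr0.
  by move: (lambda - a) la0 => c c0; rewrite scalerA mulVf// scale1r.
rewrite Rw /Fmap (FB lambda a) in Fv.
rewrite mulmxBr Fv (FB lambda a^*) -scalerDl -scalerBl.
have -> : lambda - a + (a - a^*) - (lambda - a^*) = 0.
  by move: (a^*) => b; ring.
by rewrite scale0r scaler0.
Qed.

Lemma Hdot_pencil c (w : 'cV[C]_m) :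
  Hdot G (Fmap (B c *m w)) (Fmap (B c *m w)) = (w^t* *m H c *m w) 0 0.
Proof.
rewrite HdotE /pencil_gram conjtr_mul.
by move: ((B c)^t*) (B c) => X Y; rewrite !mulmxA.
Qed.

Lemma Tmap_isometry_gram a :
  Tmap_isometry G a <-> forall w : 'cV[C]_m, E *m w = 0 ->
    (w^t* *m H a^* *m w) 0 0 = (w^t* *m H a *m w) 0 0.
Proof.
have FaB : F a *m B a = E by rewrite Fmx_pencil (subrr a) scale0r add0r.
split=> [iso w Ew|gramE f [[u _ <-] Fu]].
  have Hf : Hspace_at n a (Fmap (B a *m w)).
    by split; [exists (B a *m w)|rewrite /Fmap mulmxA FaB].
  have := iso _ Hf; rewrite (Tmap_pencil a Ew) => HI.
  exact: etrans (esym (Hdot_pencil _ _)) (etrans HI (Hdot_pencil _ _)).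
pose w := invmx (B a) *m u.
have Bw : B a *m w = u by rewrite mulKVmx// pencil_unit.
have Ew : E *m w = 0 by rewrite -FaB -mulmxA Bw.
rewrite -Bw (Tmap_pencil a Ew).
exact: etrans (Hdot_pencil _ _)
              (etrans (gramE _ Ew) (esym (Hdot_pencil _ _))).
Qed.

Lemma Tmap_isometryP a :
  Tmap_isometry G a <-> J *m H a *m J = J *m H a^* *m J.
Proof.
apply: iff_trans (Tmap_isometry_gram a) _.
move: (H a) (H a^*) => Ha Hb.
have EJ : E *m J = 0 := Fmx0_projector R n p.
have Jh : J^t* = J := projector_herm R n p.
have Jw (w : 'cV[C]_m) : E *m w = 0 -> J *m w = w.
  move=> Ew; rewrite shift_projector mulmxBl mul1mx -mulmxA Ew mulmx0.
  exact: subr0.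
move: J EJ Jh Jw => K EK Kh Kw; split=> [gramE|HK w /Kw <-].
  apply/esym/eqP; rewrite -subr_eq0; apply/eqP/quadratic_form_eq0 => x.
  have Ew : E *m (K *m x) = 0 by rewrite mulmxA EK mul0mx.
  have := gramE _ Ew; rewrite conjtr_mul Kh; move: (x^t*) => y.
  rewrite !mulmxA => HI; rewrite mulmxBr mulmxBl !mulmxA.
  by rewrite mxE HI [X in _ + X]mxE subrr.
have : w^t* *m (K *m Ha *m K) *m w = w^t* *m (K *m Hb *m K) *m w by rewrite HK.
by rewrite conjtr_mul Kh !mulmxA => ->.
Qed.

Lemma compressed_gram_eqP a : a \isn't Num.real ->
  J *m H a *m J = J *m H a^* *m J <-> A^T *m (A *m G - G *m A^T) *m A = 0.
Proof.
move=> aNreal; have ab : a^* - a != 0 by rewrite subr_eq0 -CrealE.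
have AJ : A *m (A^T *m A) = A.
  rewrite shift_projector mulmxBr mulmx1 mulmxA.
  rewrite (_ : A *m E^T = 0) ?mul0mx ?subr0//.
  by rewrite -[LHS]trmxK trmx_mul trmxK Fmx0_trshift trmx0.
have JA : A^T *m A *m A^T = A^T.
  by rewrite shift_projector mulmxBl mul1mx -mulmxA Fmx0_trshift mulmx0 subr0.
have JHJ := compressed_gram_diff G a a^* AJ JA.
rewrite /pencil_gram !pencil_conjtr conjCK.
split=> [HJ|com].
  move/eqP: HJ; rewrite -subr_eq0 JHJ scaler_eq0 (negPf ab) /=.
  by move/eqP.
by apply/eqP; rewrite -subr_eq0 JHJ com scaler0.
Qed.

(** The block at (i + 1, j + 1) of the matrix on the right is g_(i+1,j) -
    g_(i,j+1), and its blocks with a zero index vanish. Equality of neighbours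
    on each antidiagonal propagates along the whole antidiagonal. *)
Lemma block_hankelP :
  block_hankel G <-> A^T *m (A *m G - G *m A^T) *m A = 0.
Proof.
have sumE (V : nmodType) N (Nlt : (N < n.+1)%N) (f : 'I_n.+1 -> V) :
    \sum_(k < n.+1 | k == N :> nat) f k = f (Ordinal Nlt).
  exact: (big_pred1 (Ordinal Nlt)).
have sumS (V : nmodType) N (Nlt : (N.+1 < n.+1)%N) (f : 'I_n.+1 -> V) :
    \sum_(k < n.+1 | N.+1 == k.+1 :> nat) f k = f (Ordinal (ltnW Nlt)).
  by rewrite -sumE; apply: eq_bigl => k; rewrite eqSS eq_sym.
have blockE i j (ilt : (i.+1 < n.+1)%N) (jlt : (j.+1 < n.+1)%N) :
    submxblock (A^T *m (A *m G - G *m A^T) *m A) (Ordinal ilt) (Ordinal jlt) =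
    submxblock G (Ordinal ilt) (Ordinal (ltnW jlt))
      - submxblock G (Ordinal (ltnW ilt)) (Ordinal jlt).
  rewrite submxblock_shiftMr sumS submxblock_trshiftMl sumS submxblockB.
  by rewrite submxblock_shiftMl submxblock_trshiftMr !sumE.
split=> [hankG|com0].
  apply/mxblockP => -[[|i] ilt] [[|j] jlt]; rewrite submxblock0.
  - by rewrite submxblock_shiftMr big_pred0.
  - by rewrite submxblock_shiftMr sumS submxblock_trshiftMl big_pred0.
  - by rewrite submxblock_shiftMr big_pred0.
  - by rewrite blockE; apply/eqP; rewrite subr_eq0; apply/eqP/hankG;
      rewrite /= addSnnS.
pose g i j : 'M[C]_p := submxblock G (inord i) (inord j).
have ordE i (ilt : (i < n.+1)%N) : inord i = Ordinal ilt.
  by apply: val_inj; rewrite /= inordK.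
have step i j : (i.+1 < n.+1)%N -> (j.+1 < n.+1)%N -> g i.+1 j = g i j.+1.
  move=> ilt jlt; have := blockE i j ilt jlt.
  rewrite com0 submxblock0 => /esym/eqP; rewrite subr_eq0 => /eqP.
  rewrite /g (ordE _ (ltnW ilt)) (ordE _ (ltnW jlt)).
  by rewrite (ordE _ ilt) (ordE _ jlt).
have shift d i j :
    (i + d <= n)%N -> (j + d <= n)%N -> g (i + d)%N j = g i (j + d)%N.
  elim: d i j => [|d IH] i j; rewrite ?addn0// !addnS => id jd.
  rewrite step//; last exact: leq_ltn_trans (leq_addr d j) jd.
  by rewrite (IH i j.+1) ?addSn// ltnW.
have hank (i j k l : 'I_n.+1) : (i + j = k + l)%N -> (k <= i)%N ->
    submxblock G i j = submxblock G k l.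
  move=> ijkl ki; have iE : (k + (i - k) = i)%N by rewrite subnKC.
  have lE : (j + (i - k) = l)%N.
    by apply: (@addnI k); rewrite addnCA iE -ijkl addnC.
  have := shift (i - k)%N k j; rewrite iE lE /g !inord_val; apply.
    by rewrite -ltnS.
  by rewrite -ltnS.
move=> i j k l ijkl; have [ki|/ltnW ik] := leqP k i; first exact: hank.
exact/esym/hank.
Qed.

End Isometry.

Theorem theorem5p1 (R : realType) (n p : nat) (n_ge1 : (1 <= n)%N)
    (p_ge1 : (1 <= p)%N) (G : 'M[R[i]]_(blockdim n p)) (G_pos : posdefmx G) :
  (forall alpha : R[i], alpha \isn't Num.real ->
     [<-> block_hankel G;
          Tmap_isometry G alpha;
          N_kernel_identity G alpha;
          N_row_identity G alpha;
          N_matrix_identity G alpha]) /\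
  (forall alpha : R[i],
     [<-> N_kernel_identity G alpha;
          N_row_identity G alpha;
          N_matrix_identity G alpha]).
Proof.
have kerP := @N_kernel_identityP R n p G G_pos.
have rowP := @N_row_identityP R n p G G_pos.
have matP := @N_matrix_identityP R n p G.
split=> alpha => [aNreal|]; tfae.
- move=> /block_hankelP/(compressed_gram_eqP G aNreal).
  exact: (Tmap_isometryP G alpha).2.
- move=> /Tmap_isometryP/(Nred_eq_gram G_pos).
  exact: (kerP alpha).2.
- by move=> /kerP/rowP.
- by move=> /rowP/matP.
- move=> /matP/(Nred_eq_gram G_pos)/(compressed_gram_eqP G aNreal).
  exact: (block_hankelP G).2.
- by move=> /kerP/rowP.
- by move=> /rowP/matP.
- by move=> /matP/kerP.
Qed.
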